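(* Let $\mathcal F$ be an algebraic language with no nullary symbols, and let $\mathbf I=([m];\mathcal F)$ and $\mathbf A$ be finite $\mathcal F$-algebras with a surjective homomorphism $\chi\colon\mathbf A\to\mathbf I$; put $\alpha:=\ker\chi$ and $\mathbf C:=\mathfrak C(\mathbf A,\chi)$. Then for every covering pair $\delta\prec\theta$ of congruences of $\mathbf A$ with $\theta\le\alpha$ and every $\langle\delta,\theta\rangle$-trace $N$ of $\mathbf A$, there exist a $\langle\delta^*,\theta^*\rangle$-trace $\check N$ of $\mathbf C$ and a weak isomorphism $\mathbf A|_N\to\mathbf C|_{\check N}$ of the induced algebras mapping $\delta|_N$ onto $\delta^*|_{\check N}$. Consequently $\mathrm{typ}_{\mathbf A}(\delta,\theta)=\mathrm{typ}_{\mathbf C}(\delta^*,\theta^* )$, and if this type is $\mathbf 2$, then $\langle\delta,\theta\rangle$ and $\langle\delta^*,\theta^*\rangle$ have the same prime characteristic.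
   Context: Notation: $[m]=\{1,\dots,m\}$, $D^{(i)}:=\chi^{-1}(i)$. $\mathfrak C(\mathbf A,\chi)$ has universe $C=D^{(1)}\times\dots\times D^{(m)}$ (columns $\mathbf c=(c^{(1)},\dots,c^{(m)})$), an $m$-ary operation $d(\mathbf c_1,\dots,\mathbf c_m)=(c_1^{(1)},\dots,c_m^{(m)})$, and for each $k$-ary $f\in\mathcal F$ and $\mathbf i=(i_1,\dots,i_k)\in[m]^k$ a $k$-ary operation $\hat f_{\mathbf i}(\mathbf c_1,\dots,\mathbf c_k)$ obtained from $\mathbf c_1$ by replacing its $f^{\mathbf I}(\mathbf i)$-th entry by $f^{\mathbf A}(c_1^{(i_1)},\dots,c_k^{(i_k)})$. For a congruence $\beta\le\alpha$, $\beta^*=\{(\mathbf a,\mathbf b)\in C^2:(a^{(i)},b^{(i)})\in\beta\ \forall i\}$. Traces, minimal sets, induced algebras, types and weak isomorphisms are in the sense of tame congruence theory (Hobby–McKenzie). For a prime quotient of type $\mathbf 2$, the minimal algebras on traces are weakly isomorphic to one-dimensional vector spaces over a finite field; its characteristic is the characteristic of the quotient. *)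

(* Defs.v *)
From HB Require Import structures.
From mathcomp Require Import all_boot all_fingroup all_algebra.

Set Implicit Arguments.
Unset Strict Implicit.
Unset Printing Implicit Defensive.

(** * Algebras, homomorphisms and congruences *)

Record signature := Signature { symbol : Type; arity : symbol -> nat }.

Definition operation (n : nat) (T : Type) := {ffun 'I_n -> T} -> T.

Definition algebra (F : signature) (T : Type) :=
  forall f : symbol F, operation (arity f) T.

Definition homomorphism (F : signature) (T T' : Type)
    (A : algebra F T) (B : algebra F T') (h : T -> T') : Prop :=
  forall (f : symbol F) (x : {ffun 'I_(arity f) -> T}),
    h (A f x) = B f [ffun k => h (x k)].

Definition congruence (F : signature) (T : Type)
    (A : algebra F T) (r : rel T) : Prop :=
  [/\ reflexive r, symmetric r, transitive r &
      forall (f : symbol F) (x y : {ffun 'I_(arity f) -> T}),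
        (forall k, r (x k) (y k)) -> r (A f x) (A f y)].

Definition kernel (T : Type) (T' : eqType) (h : T -> T') : rel T :=
  fun x y => h x == h y.

Definition covers (F : signature) (T : Type)
    (A : algebra F T) (d t : rel T) : Prop :=
  [/\ congruence A d, congruence A t, subrel d t, ~ subrel t d &
      forall g : rel T, congruence A g -> subrel d g -> subrel g t ->
        subrel g d \/ subrel t g].

(** * Non-indexed algebras, clones and weak isomorphisms *)

(** A non-indexed algebra on [T] is a set of finitary operations on [T]. *)
Definition opset (T : Type) := forall n : nat, operation n T -> Prop.

Inductive basic_ops (F : signature) (T : Type) (A : algebra F T) : opset T :=
| BasicOp (f : symbol F) : basic_ops A (A f).

(** The term operations of [O].  [clone_ext] makes the clone insensitive to
    the intensional presentation of an operation. *)
Inductive clone (T : Type) (O : opset T) (n : nat) : operation n T -> Prop :=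
| clone_proj (i : 'I_n) : clone O (fun x => x i)
| clone_comp (k : nat) (f : operation k T) (g : 'I_k -> operation n T) :
    O k f -> (forall i, clone O (g i)) ->
    clone O (fun x => f [ffun i => g i x])
| clone_ext (f g : operation n T) : clone O f -> f =1 g -> clone O g.

Definition with_constants (T : Type) (O : opset T) : opset T :=
  fun n f => O n f \/ exists a : T, forall x, f x = a.

Definition polynomial (T : Type) (O : opset T) : opset T :=
  clone (with_constants O).

Definition unary_polynomial (T : Type) (O : opset T) (p : T -> T) : Prop :=
  @polynomial T O 1 (fun x => p (x ord0)).

(** As [phi] is bijective, every [f] has exactly one conjugate [g]. *)
Definition weak_isomorphism (T T' : Type) (O : opset T) (O' : opset T')
    (phi : T -> T') : Prop :=
  bijective phi /\
  forall (n : nat) (f : operation n T) (g : operation n T'),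
    (forall x, phi (f x) = g [ffun i => phi (x i)]) ->
    (clone O f <-> clone O' g).

(** [O] is, up to renaming of elements, polynomially equivalent to [O']. *)
Definition polynomially_isomorphic (T T' : Type)
    (O : opset T) (O' : opset T') : Prop :=
  exists phi : T -> T',
    weak_isomorphism (with_constants O) (with_constants O') phi.

(** The induced algebra [A|_N]: all restrictions to [N] of the polynomial
    operations of [O] that preserve [N]. *)
Definition induced (T : finType) (O : opset T) (N : {set T}) :
    opset {x : T | x \in N} :=
  fun n g => exists2 f : operation n T, polynomial O f &
    forall x : {ffun 'I_n -> {x : T | x \in N}},
      f [ffun i => val (x i)] = val (g x).

Definition restrict (T : finType) (r : rel T) (N : {set T}) :
    rel {x : T | x \in N} :=
  fun x y => r (val x) (val y).

Definition blocks (T : finType) (r : rel T) : finType :=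
  {B : {set T} | B \in equivalence_partition r [set: T]}.

Definition quotient_ops (T : finType) (O : opset T) (r : rel T) :
    opset (blocks r) :=
  fun n g => exists2 f : operation n T, O n f &
    forall (x : {ffun 'I_n -> T}) (B : {ffun 'I_n -> blocks r}),
      (forall i, x i \in val (B i)) -> f x \in val (g B).

(** * Minimal sets, traces, types and characteristic (Hobby--McKenzie) *)

Definition separating_image (F : signature) (T : finType) (A : algebra F T)
    (d t : rel T) (U : {set T}) : Prop :=
  exists p : T -> T,
    [/\ unary_polynomial (basic_ops A) p,
        exists x y, t x y && ~~ d (p x) (p y) &
        U = [set p x | x : T]].

Definition minimal_set (F : signature) (T : finType) (A : algebra F T)
    (d t : rel T) (U : {set T}) : Prop :=
  separating_image A d t U /\
  forall V : {set T}, separating_image A d t V -> V \subset U -> V = U.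

Definition trace (F : signature) (T : finType) (A : algebra F T)
    (d t : rel T) (N : {set T}) : Prop :=
  exists (U : {set T}) (x : T),
    [/\ minimal_set A d t U, x \in U, N = [set y in U | t x y] &
        ~ (N \subset [set y | d x y])].

Definition minimal_algebra (T : finType) (O : opset T) : Prop :=
  1 < #|T| /\
  forall p : T -> T, unary_polynomial O p ->
    (exists a : T, forall x, p x = a) \/ bijective p.

Inductive perm_ops (T : finType) (G : {set {perm T}}) : opset T :=
| PermOp (s : {perm T}) : s \in G ->
    perm_ops G (fun x : {ffun 'I_1 -> T} => s (x ord0)).

Inductive vector_space_ops (K : fieldType) (V : lmodType K) : opset V :=
| VZero : vector_space_ops (fun _ : {ffun 'I_0 -> V} => 0%R)
| VOpp : vector_space_ops (fun x : {ffun 'I_1 -> V} => (- x ord0)%R)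
| VAdd : vector_space_ops
    (fun x : {ffun 'I_2 -> V} => (x ord0 + x ord_max)%R)
| VScale (k : K) : vector_space_ops
    (fun x : {ffun 'I_1 -> V} => (k *: x ord0)%R).

Inductive semilattice_ops : opset bool :=
| SMeet : semilattice_ops
    (fun x : {ffun 'I_2 -> bool} => x ord0 && x ord_max).

Inductive lattice_ops : opset bool :=
| LMeet : lattice_ops (fun x : {ffun 'I_2 -> bool} => x ord0 && x ord_max)
| LJoin : lattice_ops (fun x : {ffun 'I_2 -> bool} => x ord0 || x ord_max).

Inductive boolean_ops : opset bool :=
| BZero : boolean_ops (fun _ : {ffun 'I_0 -> bool} => false)
| BOne : boolean_ops (fun _ : {ffun 'I_0 -> bool} => true)
| BMeet : boolean_ops (fun x : {ffun 'I_2 -> bool} => x ord0 && x ord_max)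
| BJoin : boolean_ops (fun x : {ffun 'I_2 -> bool} => x ord0 || x ord_max)
| BCompl : boolean_ops (fun x : {ffun 'I_1 -> bool} => ~~ x ord0).

Inductive tct_type :=
| Type1_unary | Type2_affine | Type3_boolean | Type4_lattice
| Type5_semilattice.

Definition minimal_algebra_type (T : finType) (O : opset T) (i : tct_type) :
    Prop :=
  minimal_algebra O /\
  match i with
  | Type1_unary =>
      exists G : {group {perm T}}, polynomially_isomorphic O (perm_ops G)
  | Type2_affine =>
      exists (K : finFieldType) (V : finLmodType K),
        polynomially_isomorphic O (@vector_space_ops K V)
  | Type3_boolean => polynomially_isomorphic O boolean_ops
  | Type4_lattice => polynomially_isomorphic O lattice_ops
  | Type5_semilattice => polynomially_isomorphic O semilattice_ops
  end.

(** [(A|_N) / (d|_N)]. *)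
Definition trace_quotient (F : signature) (T : finType) (A : algebra F T)
    (d : rel T) (N : {set T}) : opset (blocks (restrict d (N := N))) :=
  quotient_ops (induced (basic_ops A) (N := N)) (r := restrict d (N := N)).

(** Graph of the partial function [(d, t) |-> typ(d, t)], whose domain is the
    set of prime quotients; a prime quotient always has a trace. *)
Definition has_type (F : signature) (T : finType) (A : algebra F T)
    (d t : rel T) (i : tct_type) : Prop :=
  covers A d t /\
  forall N : {set T}, trace A d t N ->
    minimal_algebra_type (@trace_quotient F T A d N) i.

(** [K^o] is the one-dimensional vector space over [K]. *)
Definition has_characteristic (F : signature) (T : finType)
    (A : algebra F T) (d t : rel T) (p : nat) : Prop :=
  covers A d t /\
  forall N : {set T}, trace A d t N ->
    exists K : finFieldType,
      p \in [pchar K]%R /\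
      polynomially_isomorphic (@trace_quotient F T A d N)
        (@vector_space_ops K K^o%type).

(** * The algebra of columns *)

Definition column (m : nat) (T : finType) (chi : T -> 'I_m) : finType :=
  {c : {ffun 'I_m -> T} | [forall i, chi (c i) == i]}.

Inductive column_symbol (F : signature) (m : nat) : Type :=
| ColD
| ColHat (f : symbol F) (i : {ffun 'I_(arity f) -> 'I_m}).

Definition column_signature (F : signature) (m : nat) : signature :=
  @Signature (column_symbol F m)
    (fun s => match s with ColD => m | ColHat f _ => arity f end).

Section ColumnAlgebra.

Variables (F : signature) (F_pos : forall f : symbol F, 0 < arity f).
Variables (m : nat) (I : algebra F 'I_m) (T : finType) (A : algebra F T).
Variables (chi : T -> 'I_m) (chi_hom : homomorphism A I chi).

Lemma columnP (c : column chi) (i : 'I_m) : chi (val c i) = i.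
Proof. by apply/eqP; move/forallP: (valP c). Qed.

Definition col_d_val (c : {ffun 'I_m -> column chi}) : {ffun 'I_m -> T} :=
  [ffun j => val (c j) j].

Lemma col_d_subproof c : [forall i, chi (col_d_val c i) == i].
Proof. by apply/forallP => i; rewrite ffunE columnP. Qed.

Definition col_d (c : {ffun 'I_m -> column chi}) : column chi :=
  Sub (col_d_val c) (col_d_subproof c).

Definition col_hat_val (f : symbol F) (i : {ffun 'I_(arity f) -> 'I_m})
    (c : {ffun 'I_(arity f) -> column chi}) : {ffun 'I_m -> T} :=
  [ffun j => if j == I i then A [ffun k => val (c k) (i k)]
             else val (c (Ordinal (F_pos f))) j].

Lemma col_hat_subproof f (i : {ffun 'I_(arity f) -> 'I_m}) c :
  [forall j, chi (col_hat_val i c j) == j].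
Proof.
apply/forallP => j; rewrite ffunE; case: (j =P I i) => [->|_]; last by rewrite columnP.
rewrite chi_hom; apply/eqP; congr (I _); apply/ffunP => k.
by rewrite !ffunE columnP.
Qed.

Definition col_hat (f : symbol F) (i : {ffun 'I_(arity f) -> 'I_m})
    (c : {ffun 'I_(arity f) -> column chi}) : column chi :=
  Sub (col_hat_val i c) (col_hat_subproof i c).

Definition column_algebra : algebra (column_signature F m) (column chi) :=
  fun s => match s with
           | ColD => col_d
           | ColHat f i => @col_hat f i
           end.

End ColumnAlgebra.

Definition star (m : nat) (T : finType) (chi : T -> 'I_m) (b : rel T) :
    rel (column chi) :=
  fun x y => [forall i, b (val x i) (val y i)].

(* Main.v *)
(** Coordinatewise, the polynomials of the column algebra are exactly the
    tuples of polynomials of [A] in the coordinates of the arguments that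
    respect [chi].  Hence, for a minimal set [U = e(A)] and a trace [N] inside
    the fibre of [chi] over [i0], inserting the elements of [U] in that fibre
    as the [i0]-th entry of a fixed column [o] gives a minimal set of [C], and
    the copy of [N] in it is a trace with the same induced algebra.

    Since all traces of a prime quotient are polynomially isomorphic, comparing
    one trace on each side transfers the type and the characteristic.  In type 2
    the trace modulo [delta] is simple while the unary polynomials of a vector
    space are affine, so the space is one-dimensional. *)

From mathcomp Require Import all_boot all_fingroup all_algebra.
From mathcomp Require Import finfield boolp.
Require Import Defs.

Set Implicit Arguments.
Unset Strict Implicit.
Unset Printing Implicit Defensive.

(** * Clones and weak isomorphisms *)

Lemma clone_sub (T : Type) (O : opset T) (k n : nat) (f : operation k T)
    (g : 'I_k -> operation n T) :
  clone O f -> (forall i, clone O (g i)) ->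
  clone O (fun x => f [ffun i => g i x]).
Proof.
move=> Of Og; elim: Of => [i|l h u Oh _ IH|h h' _ IH hE].
- by apply: clone_ext (Og i) _ => x; rewrite ffunE.
- apply: clone_ext (clone_comp Oh IH) _ => x.
  by congr (h _); apply/ffunP => i; rewrite !ffunE.
- by apply: clone_ext IH _ => x; apply: hE.
Qed.

Lemma clone_op (T : Type) (O : opset T) (n : nat) (f : operation n T) :
  O n f -> clone O f.
Proof.
move=> Of; apply: clone_ext (clone_comp Of (fun i => clone_proj O i)) _ => x.
by congr f; apply/ffunP => i; rewrite ffunE.
Qed.

Lemma polynomial_const (T : Type) (O : opset T) (n : nat) (a : T) :
  @polynomial T O n (fun=> a).
Proof. by apply: clone_op; right; exists a. Qed.

Lemma polynomial_op (T : Type) (O : opset T) (n : nat) (f : operation n T) :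
  O n f -> polynomial O f.
Proof. by move=> Of; apply: clone_op; left. Qed.

Definition conj_op (T T' : Type) (phi : T -> T') (psi : T' -> T) (n : nat)
    (f : operation n T) : operation n T' :=
  fun x => phi (f [ffun i => psi (x i)]).

(** Conjugation commutes with composition because [psi] undoes [phi] on the inner values, so only
    the basic operations need checking. *)
Lemma clone_conj (T T' : Type) (O : opset T) (O' : opset T')
    (phi : T -> T') (psi : T' -> T) :
  cancel phi psi -> cancel psi phi ->
  (forall n f, O n f -> clone O' (conj_op phi psi f)) ->
  forall n (f : operation n T), clone O f -> clone O' (conj_op phi psi f).
Proof.
move=> phiK psiK OO' n f; elim=> [i|k h u Oh _ IH|h h' _ IH hE].
- by apply: clone_ext (clone_proj _ i) _ => x; rewrite /conj_op ffunE psiK.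
- apply: clone_ext (clone_sub (OO' _ _ Oh) IH) _ => x.
  by congr (phi (h _)); apply/ffunP => i; rewrite !ffunE phiK.
- by apply: clone_ext IH _ => x; congr phi; apply: hE.
Qed.

Lemma weak_isomorphism_conj (T T' : Type) (O : opset T) (O' : opset T')
    (phi : T -> T') (psi : T' -> T) :
  cancel phi psi -> cancel psi phi ->
  (forall n f, O n f -> clone O' (conj_op phi psi f)) ->
  (forall n f, O' n f -> clone O (conj_op psi phi f)) ->
  weak_isomorphism O O' phi.
Proof.
move=> phiK psiK OO' O'O; split; first by exists psi.
move=> n f g fg; split=> [Of|Og].
  apply: clone_ext (clone_conj phiK psiK OO' Of) _ => x.
  by rewrite /conj_op fg; congr g; apply/ffunP => i; rewrite !ffunE psiK.
apply: clone_ext (clone_conj psiK phiK O'O Og) _ => x.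
by rewrite /conj_op -fg phiK.
Qed.

Lemma weak_isomorphism_inv (T T' : Type) (O : opset T) (O' : opset T')
    (phi : T -> T') :
  weak_isomorphism O O' phi ->
  exists psi, [/\ cancel phi psi, cancel psi phi,
    forall n (f : operation n T), clone O f -> clone O' (conj_op phi psi f) &
    forall n (g : operation n T'), clone O' g -> clone O (conj_op psi phi g)].
Proof.
case=> -[psi phiK psiK] OO'; exists psi; split=> // n f Of.
  apply/(OO' n f) => // x; congr (phi (f _)).
  by apply/ffunP => i; rewrite !ffunE phiK.
by apply/(OO' n _ f) => // x; rewrite psiK.
Qed.

Lemma polynomially_isomorphic_conj (T T' : Type) (O : opset T)
    (O' : opset T') (phi : T -> T') (psi : T' -> T) :
  cancel phi psi -> cancel psi phi ->
  (forall n f, O n f -> polynomial O' (conj_op phi psi f)) ->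
  (forall n f, O' n f -> polynomial O (conj_op psi phi f)) ->
  polynomially_isomorphic O O'.
Proof.
move=> phiK psiK OO' O'O; exists phi.
apply: (weak_isomorphism_conj phiK psiK) => n f [|[a fE]].
- exact: OO'.
- apply: clone_ext (polynomial_const _ _ (phi a)) _ => x.
  by rewrite /conj_op fE.
- exact: O'O.
- apply: clone_ext (polynomial_const _ _ (psi a)) _ => x.
  by rewrite /conj_op fE.
Qed.

Lemma polynomially_isomorphic_sym (T T' : Type) (O : opset T)
    (O' : opset T') :
  polynomially_isomorphic O O' -> polynomially_isomorphic O' O.
Proof.
case=> phi /weak_isomorphism_inv[psi [phiK psiK OO' O'O]]; exists psi.
apply: (weak_isomorphism_conj psiK phiK) => n f Of.
  exact/O'O/clone_op.
exact/OO'/clone_op.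
Qed.

Lemma polynomially_isomorphic_trans (T T' T'' : Type) (O : opset T)
    (O' : opset T') (O'' : opset T'') :
  polynomially_isomorphic O O' -> polynomially_isomorphic O' O'' ->
  polynomially_isomorphic O O''.
Proof.
case=> phi [bij_phi OO'] [phi' [bij_phi' O'O'']].
exists (phi' \o phi); split; first exact: bij_comp.
case: bij_phi => psi phiK psiK n f g fg.
have fh x : phi (f x) = conj_op phi psi f [ffun i => phi (x i)].
  by congr (phi (f _)); apply/ffunP => i; rewrite !ffunE phiK.
have hg x : phi' (conj_op phi psi f x) = g [ffun i => phi' (x i)].
  rewrite /conj_op [LHS]fg; congr g; apply/ffunP => i.
  by rewrite !ffunE /= psiK.
by split=> [/(OO' _ _ _ fh)/(O'O'' _ _ _ hg)|/(O'O'' _ _ _ hg)/(OO' _ _ _ fh)].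
Qed.

(** * Invariance of minimality and type under polynomial isomorphism *)

Lemma minimal_algebra_isomorphic (T T' : finType) (O : opset T)
    (O' : opset T') :
  polynomially_isomorphic O O' -> minimal_algebra O -> minimal_algebra O'.
Proof.
case=> phi iso [T_gt1 Omin]; have bij_phi := iso.1.
have [psi [phiK psiK _ O'O]] := weak_isomorphism_inv iso.
split; first by rewrite -(bij_eq_card bij_phi).
move=> p /O'O Op; have [|[a pE]|bij_p] := Omin (psi \o p \o phi).
- by apply: clone_ext Op _ => x; rewrite /conj_op ffunE.
- left; exists (phi a) => x.
  by rewrite -(psiK (p x)) -{1}(psiK x); congr phi; apply: pE.
- right; apply: (@eq_bij _ _ (phi \o (psi \o p \o phi) \o psi)).
    apply: bij_comp; last by exists phi.
    exact: bij_comp.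
  by move=> x; rewrite /= !psiK.
Qed.

(** In type [Type1_unary] the model lives on the carrier of the algebra itself, so the group has to
    be moved along the bijection; the other models have carriers of their own. *)
Lemma perm_ops_transport (T T' : finType) (phi : T -> T')
    (G : {group {perm T}}) :
  bijective phi ->
  exists G' : {group {perm T'}},
    polynomially_isomorphic (perm_ops G) (perm_ops G').
Proof.
case=> psi phiK psiK.
have cj_inj (s : {perm T}) : injective (fun x => phi (s (psi x))).
  by move=> x y /(can_inj phiK)/perm_inj/(can_inj psiK).
pose cj s := perm (cj_inj s).
have G'_group : group_set [set cj s | s in G].
  apply/group_setP; split.
    by apply/imsetP; exists 1%g => //; apply/permP => x; rewrite !permE psiK.
  move=> _ _ /imsetP[s Gs ->] /imsetP[u Gu ->]; apply/imsetP.
  exists (s * u)%g; first exact: groupM.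
  by apply/permP => x; rewrite !permE /= !permE phiK.
exists (Group G'_group).
apply: (polynomially_isomorphic_conj phiK psiK) => n _ [s Gs].
  apply: clone_ext (polynomial_op (PermOp (imset_f cj Gs))) _ => x.
  by rewrite /conj_op !permE ffunE.
case/imsetP: Gs => u Gu ->; apply: clone_ext (polynomial_op (PermOp Gu)) _ => x.
by rewrite /conj_op !permE ffunE !phiK.
Qed.

Lemma minimal_algebra_type_isomorphic (T T' : finType) (O : opset T)
    (O' : opset T') (i : tct_type) :
  polynomially_isomorphic O O' -> minimal_algebra_type O i ->
  minimal_algebra_type O' i.
Proof.
move=> OO' [Omin Oi]; split; first exact: minimal_algebra_isomorphic Omin.
have tr S (P : opset S) :
    polynomially_isomorphic O P -> polynomially_isomorphic O' P.
  exact/polynomially_isomorphic_trans/polynomially_isomorphic_sym.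
case: i Oi => [[G OG]|[K [V OV]]|||] //; try exact: tr.
- have [phi [bij_phi _]] := OO'.
  have [G' GG'] := perm_ops_transport G bij_phi; exists G'.
  exact/tr/polynomially_isomorphic_trans/GG'.
- by exists K, V; apply: tr.
Qed.

(** * Quotients *)

Section Quotients.

Variables (T : finType) (r : rel T).

Lemma block_subproof (x : T) :
  [set y in [set: T] | r x y] \in equivalence_partition r [set: T].
Proof. exact: imset_f. Qed.

Definition block (x : T) : blocks r :=
  exist (fun B => B \in equivalence_partition r [set: T]) _ (block_subproof x).

Lemma blocks_inj (B C : blocks r) : val B = val C -> B = C.
Proof. exact: val_inj. Qed.

Hypothesis equiv_r : [/\ reflexive r, symmetric r & transitive r].

Lemma eq_blockP (x y : T) : reflect (block x = block y) (r x y).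
Proof.
have [r_refl r_sym r_trans] := equiv_r; apply: (iffP idP) => [rxy|].
  apply/blocks_inj/setP => z; rewrite !inE /=.
  apply/idP/idP; last exact: r_trans.
  by apply: r_trans; rewrite r_sym.
by move/(congr1 val)/setP/(_ y); rewrite !inE r_refl.
Qed.

Lemma block_surj (B : blocks r) : exists x, block x == B.
Proof. by have /imsetP[x _ BE] := valP B; exists x; apply/eqP/blocks_inj. Qed.

Definition block_repr (B : blocks r) : T := xchoose (block_surj B).

Lemma block_reprK : cancel block_repr block.
Proof. by move=> B; apply/eqP; apply: (xchooseP (block_surj B)). Qed.

Lemma mem_blockP (x : T) (B : blocks r) : reflect (block x = B) (x \in val B).
Proof.
have [_ r_sym _] := equiv_r; rewrite -(block_reprK B).
have -> : (x \in val (block (block_repr B))) = r x (block_repr B).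
  by rewrite r_sym !inE.
exact: eq_blockP.
Qed.

(** Membership in blocks becomes an equation: [block] intertwines [f] and [g]. *)
Lemma quotient_opsP (O : opset T) (n : nat) (g : operation n (blocks r)) :
  quotient_ops O g <->
  exists2 f : operation n T, O n f &
    forall x : {ffun 'I_n -> T}, g [ffun i => block (x i)] = block (f x).
Proof.
split=> -[f Of fg]; exists f => // x.
  by apply/esym/mem_blockP/fg => i; apply/mem_blockP; rewrite ffunE.
move=> B xB; apply/mem_blockP; rewrite -fg; congr g.
by apply/ffunP => i; rewrite ffunE; apply/mem_blockP.
Qed.

End Quotients.

Section QuotientIsomorphism.

Variables (T T' : finType) (r : rel T) (r' : rel T').
Hypothesis equiv_r : [/\ reflexive r, symmetric r & transitive r].
Hypothesis equiv_r' : [/\ reflexive r', symmetric r' & transitive r'].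

(** Going through a representative makes the map total; when [phi] respects the relations, the
    choice does not matter. *)
Definition block_map (phi : T -> T') (B : blocks r) : blocks r' :=
  block r' (phi (block_repr B)).

Lemma block_map_block (phi : T -> T') (x : T) :
  {homo phi : x y / r x y >-> r' x y} ->
  block_map phi (block r x) = block r' (phi x).
Proof.
move=> phi_r; apply/(eq_blockP equiv_r')/phi_r/(eq_blockP equiv_r).
exact: block_reprK.
Qed.

End QuotientIsomorphism.

Lemma block_mapK (T T' : finType) (r : rel T) (r' : rel T')
    (phi : T -> T') (psi : T' -> T) :
  [/\ reflexive r, symmetric r & transitive r] ->
  [/\ reflexive r', symmetric r' & transitive r'] ->
  {homo psi : x y / r' x y >-> r x y} -> cancel phi psi ->
  cancel (block_map r' phi) (block_map r psi).
Proof.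
move=> Er Er' psi_r phiK B; rewrite /block_map -/(block_map r psi _).
by rewrite (block_map_block Er' Er _ psi_r) phiK block_reprK.
Qed.

Lemma quotient_ops_conj (T T' : finType) (O : opset T) (O' : opset T')
    (r : rel T) (r' : rel T') (phi : T -> T') (psi : T' -> T) :
  [/\ reflexive r, symmetric r & transitive r] ->
  [/\ reflexive r', symmetric r' & transitive r'] ->
  {homo phi : x y / r x y >-> r' x y} ->
  {homo psi : x y / r' x y >-> r x y} ->
  (forall n f, O n f -> O' n (conj_op phi psi f)) ->
  forall n (g : operation n (blocks r)), quotient_ops O g ->
    quotient_ops O' (conj_op (block_map r' phi) (block_map r psi) g).
Proof.
move=> Er Er' phi_r psi_r OO' n g /(quotient_opsP Er)[f Of fg].
apply/(quotient_opsP Er'); exists (conj_op phi psi f); first exact: OO'.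
move=> x; rewrite /conj_op -(block_map_block Er Er' _ phi_r) -fg.
congr (block_map _ _ (g _)).
by apply/ffunP => i; rewrite !ffunE (block_map_block Er' Er _ psi_r).
Qed.

Lemma quotient_isomorphic (T T' : finType) (O : opset T) (O' : opset T')
    (r : rel T) (r' : rel T') (phi : T -> T') (psi : T' -> T) :
  [/\ reflexive r, symmetric r & transitive r] ->
  [/\ reflexive r', symmetric r' & transitive r'] ->
  cancel phi psi -> cancel psi phi ->
  (forall x y, r x y = r' (phi x) (phi y)) ->
  (forall n f, O n f -> O' n (conj_op phi psi f)) ->
  (forall n f, O' n f -> O n (conj_op psi phi f)) ->
  polynomially_isomorphic (quotient_ops O (r := r))
    (quotient_ops O' (r := r')).
Proof.
move=> Er Er' phiK psiK phi_r OO' O'O.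
have phi_h : {homo phi : x y / r x y >-> r' x y} by move=> x y; rewrite phi_r.
have psi_h : {homo psi : x y / r' x y >-> r x y}.
  by move=> x y; rewrite phi_r !psiK.
apply: (polynomially_isomorphic_conj (phi := block_map r' phi)
          (psi := block_map r psi)); try exact: block_mapK.
  move=> n f Of.
  exact: polynomial_op (quotient_ops_conj _ _ phi_h psi_h OO' Of).
move=> n f Of.
exact: polynomial_op (quotient_ops_conj _ _ psi_h phi_h O'O Of).
Qed.

(** * Induced algebras *)

(** Composing polynomials that extend the given operations yields an extension of the composite, so
    the induced algebra is already a clone and facts about its clone are facts about [induced]. *)
Lemma clone_induced (T : finType) (O : opset T) (N : {set T}) (n : nat)
    (f : operation n {x | x \in N}) :
  clone (induced O (N := N)) f -> induced O f.
Proof.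
elim=> [i|k h u [h' Oh' hE] _ IH|h h' _ [f' Of' fE] hh'].
- by exists (fun x => x i) => [|x]; [apply: clone_proj | rewrite ffunE].
- have [u' Ou' uE] := fin_all_exists2 IH.
  exists (fun x => h' [ffun i => u' i x]) => [|x].
    exact: clone_sub.
  by rewrite -hE; congr h'; apply/ffunP => i; rewrite !ffunE uE.
- by exists f' => // x; rewrite -hh'.
Qed.

Lemma restrict_equiv (T : finType) (r : rel T) (N : {set T}) :
  [/\ reflexive r, symmetric r & transitive r] ->
  [/\ reflexive (restrict r (N := N)), symmetric (restrict r (N := N))
    & transitive (restrict r (N := N))].
Proof.
case=> r_refl r_sym r_trans; split=> [x|x y|y x z].
- exact: r_refl.
- exact: r_sym.
- exact: r_trans.
Qed.

(** * Unary polynomials and congruences *)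

Lemma unary_polynomial_comp (T : Type) (O : opset T) (n : nat) (p : T -> T)
    (f : operation n T) :
  unary_polynomial O p -> polynomial O f -> polynomial O (fun x => p (f x)).
Proof.
move=> Op Of; apply: clone_ext (clone_sub Op (fun=> Of)) _ => x.
by rewrite ffunE.
Qed.

Lemma unary_polynomial_id (T : Type) (O : opset T) : unary_polynomial O id.
Proof. exact: clone_proj. Qed.

Lemma unary_polynomial_iter (T : Type) (O : opset T) (p : T -> T) (n : nat) :
  unary_polynomial O p -> unary_polynomial O (iter n p).
Proof.
move=> Op; elim: n => [|n IH]; first exact: unary_polynomial_id.
exact: (unary_polynomial_comp Op IH).
Qed.

Lemma polynomial_congruence (F : signature) (T : Type) (A : algebra F T)
    (r : rel T) (n : nat) (f : operation n T) :
  congruence A r -> polynomial (basic_ops A) f ->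
  forall x y : {ffun 'I_n -> T}, (forall i, r (x i) (y i)) -> r (f x) (f y).
Proof.
case=> r_refl r_sym r_trans r_op Of x y rxy.
elim: Of => [i|k h g Oh _ IH|h h' _ IH hE] //; last by rewrite -!hE.
case: Oh g IH => [[s] g IH|[a hE] g IH]; last by rewrite !hE.
by apply: r_op => i; rewrite !ffunE.
Qed.

Lemma unary_polynomial_congruence (F : signature) (T : Type)
    (A : algebra F T) (r : rel T) (p : T -> T) :
  congruence A r -> unary_polynomial (basic_ops A) p ->
  {homo p : x y / r x y}.
Proof.
move=> Ar Ap x y rxy.
by have := polynomial_congruence (x := [ffun=> x]) (y := [ffun=> y]) Ar Ap;
  rewrite !ffunE; apply => i; rewrite !ffunE.
Qed.

(** The tuple [x] is turned into [y] one coordinate at a time, in increasing order, so [P] only has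
    to survive a single replacement. *)
Lemma ffun_path (n : nat) (T : Type) (x y : {ffun 'I_n -> T})
    (P : {ffun 'I_n -> T} -> Prop) :
  P x ->
  (forall (z : {ffun 'I_n -> T}) i,
    (forall k, z k = x k \/ z k = y k) -> z i = x i -> P z ->
    P [ffun k => if k == i then y i else z k]) ->
  P y.
Proof.
move=> Px Pstep.
pose z l : {ffun 'I_n -> T} := [ffun k : 'I_n => if k < l then y k else x k].
suff Pz l : l <= n -> P (z l).
  by have := Pz n (leqnn n); congr P; apply/ffunP => k; rewrite ffunE ltn_ord.
elim: l => [|l IH] ln.
  by suff -> : z 0 = x by []; apply/ffunP => k; rewrite ffunE.
have := Pstep (z l) (Ordinal ln); rewrite !ffunE ltnn.
move=> /(_ _ erefl (IH (ltnW ln))); suff -> : z l.+1 =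
    [ffun k => if k == Ordinal ln then y (Ordinal ln) else z l k].
  by apply=> k; rewrite !ffunE; case: ifP => _; [right | left].
apply/ffunP => k; rewrite !ffunE ltnS leq_eqVlt.
by case: (k =P Ordinal ln) => [->|/eqP]; rewrite /= ?eqxx // -val_eqE
  => /negPf->.
Qed.

(** Related tuples are joined by a chain changing one argument at a time, and each link is an
    instance of a unary polynomial. *)
Lemma congruence_of_unary (F : signature) (T : Type) (A : algebra F T)
    (r : rel T) :
  reflexive r -> symmetric r -> transitive r ->
  (forall p, unary_polynomial (basic_ops A) p -> {homo p : x y / r x y}) ->
  congruence A r.
Proof.
move=> r_refl r_sym r_trans r_poly; split=> // f x y rxy.
apply: (ffun_path (P := fun z => r (A f x) (A f z))) => // z i _ zi.
move/r_trans; apply.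
(* The basic operation with all arguments but the [i]-th frozen at [z]. *)
pose p u := A f [ffun k => if k == i then u else z k].
have <- : p (z i) = A f z.
  by congr (A f); apply/ffunP => k; rewrite ffunE; case: (k =P i) => [->|].
rewrite zi; apply: (r_poly p) => //.
have Ag k : polynomial (basic_ops A)
    (fun u : {ffun 'I_1 -> T} => if k == i then u ord0 else z k).
  by case: (k == i); [apply: clone_proj | apply: polynomial_const].
exact: clone_sub (polynomial_op (BasicOp A f)) Ag.
Qed.

Lemma congruence_equiv (F : signature) (T : Type) (A : algebra F T)
    (r : rel T) :
  congruence A r -> [/\ reflexive r, symmetric r & transitive r].
Proof. by case. Qed.

(** * Minimal sets and traces of a prime quotient *)

(** Extended by the identity outside [U], the map is a permutation of a finite set, and its order is
    the exponent. The form [n.+1] records that [s] is applied at least once. *)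
Lemma iter_id_on (T : finType) (U : {set T}) (s : T -> T) :
  {in U, forall x, s x \in U} -> {in U &, injective s} ->
  exists n, {in U, forall x, iter n.+1 s x = x}.
Proof.
move=> sU s_inj; pose s' x := if x \in U then s x else x.
have s'_inj : injective s'.
  move=> x y; rewrite /s'; case: ifP => Ux; case: ifP => Uy //.
  - exact: s_inj.
  - by move=> xy; rewrite -xy sU in Uy.
  - by move=> xy; rewrite xy sU in Ux.
pose g := perm s'_inj; exists #[g]%g.-1 => x Ux.
rewrite prednK ?order_gt0 // -[RHS]perm1 -(expg_order g) permX.
elim: #[g]%g => //= n ->; rewrite permE /s' ifT //.
by elim: n => //= n IH; rewrite permE /s' IH sU.
Qed.

Section PrimeQuotient.

Variables (F : signature) (T : finType) (A : algebra F T) (d t : rel T).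
Hypothesis cov : covers A d t.

Let equiv_d : [/\ reflexive d, symmetric d & transitive d].
Proof. by have [/congruence_equiv] := cov. Qed.

Let equiv_t : [/\ reflexive t, symmetric t & transitive t].
Proof. by have [_ /congruence_equiv] := cov. Qed.

Let d_poly p : unary_polynomial (basic_ops A) p -> {homo p : x y / d x y}.
Proof.
by have [/unary_polynomial_congruence d_p _ _ _ _] := cov; apply: d_p.
Qed.

Let t_poly p : unary_polynomial (basic_ops A) p -> {homo p : x y / t x y}.
Proof.
by have [_ /unary_polynomial_congruence t_p _ _ _] := cov; apply: t_p.
Qed.

(** Maltsev's description of the congruence generated by [d] and [(a, b)], which
    is [t] because [d] is covered by [t]. *)
Lemma covers_generated (a b : T) (R : T -> T -> Prop) :
  t a b -> ~ d a b ->
  (forall x, R x x) -> (forall x y, R x y -> R y x) ->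
  (forall x y z, R x y -> R y z -> R x z) -> (forall x y, d x y -> R x y) ->
  (forall p, unary_polynomial (basic_ops A) p -> R (p a) (p b)) ->
  forall x y, t x y -> R x y.
Proof.
have [d_refl d_sym d_trans] := equiv_d.
have [t_refl t_sym t_trans] := equiv_t.
move=> tab dab R_refl R_sym R_trans dR R_ab.
pose adm (S : T -> T -> Prop) :=
  [/\ forall x, S x x, forall x y, S x y -> S y x,
      forall x y z, S x y -> S y z -> S x z, forall x y, d x y -> S x y &
      forall p, unary_polynomial (basic_ops A) p -> S (p a) (p b)].
(* The intersection of all admissible relations, cut down to [t]; covering leaves only [d] or [t]
   for it. *)
pose G x y := t x y && `[< forall S, adm S -> S x y >].
have GA : congruence A G.
  apply: congruence_of_unary => [x|x y|y x z|p Ap x y].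
  - by rewrite /G t_refl; apply/asboolP => S [].
  - rewrite /G t_sym; congr andb; apply/asboolP/asboolP => H S admS;
      by have [_ S_sym _ _ _] := admS; exact: S_sym (H S admS).
  - move=> /andP[txy /asboolP xy] /andP[tyz /asboolP yz].
    rewrite /G (t_trans _ _ _ txy tyz); apply/asboolP => S admS.
    by have [_ _ S_trans _ _] := admS; apply: S_trans (xy S admS) (yz S admS).
  - move=> /andP[txy /asboolP xy]; rewrite /G t_poly //=.
    apply/asboolP => S [S_refl S_sym S_trans dS S_ab].
    (* The preimage of an admissible relation under a polynomial [p] is again admissible. *)
    apply: (xy (fun x y => S (p x) (p y))); split=> [u|u v|u v w|u v|q Aq].
    + exact: S_refl.
    + exact: S_sym.
    + exact: S_trans.
    + by move/(d_poly Ap)/dS.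
    + exact: (S_ab (p \o q) (unary_polynomial_comp Ap Aq)).
have [_ _ dt _ prime_dt] := cov.
have dG : subrel d G.
  by move=> x y dxy; rewrite /G dt //=; apply/asboolP => S [_ _ _ /(_ _ _ dxy)].
have Gt : subrel G t by move=> x y /andP[].
have Gab : G a b.
  rewrite /G tab; apply/asboolP => S [_ _ _ _ S_ab].
  exact: S_ab (unary_polynomial_id _).
case: (prime_dt G GA dG Gt) => [/(_ _ _ Gab)//|tG] x y.
by move=> /tG/andP[_ /asboolP]; apply.
Qed.

(** Otherwise [k] would collapse, modulo [d], every polynomial image of [(a, b)] lying in the
    [t]-class of [x]. As these images and [d] generate [t], the pair [(x, y)] would be collapsed
    too. *)
Lemma covers_separate (a b x y : T) (k : T -> T) :
  t a b -> ~ d a b -> t x y ->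
  {homo k : u v / d u v} -> ~ d (k x) (k y) ->
  exists p, [/\ unary_polynomial (basic_ops A) p, t x (p a) &
                ~ d (k (p a)) (k (p b))].
Proof.
have [d_refl d_sym d_trans] := equiv_d.
have [t_refl t_sym t_trans] := equiv_t; have [_ _ dt _ _] := cov.
move=> tab dab txy dk dkxy; apply: contrapT => nop.
(* The first conjunct makes [R] transitive: a chain can neither enter nor leave the class of [x]. *)
pose R u v := (t x u = t x v) /\ (t x u -> d (k u) (k v)).
have txR u v : t u v -> t x u = t x v.
  by move=> tuv; apply/idP/idP => /t_trans; apply; rewrite // t_sym.
have [] // : R x y -> False.
  by case=> _ /(_ (t_refl x)).
apply: (covers_generated tab dab) txy => [u|u v|u v w|u v duv|p Ap].
- by split.
- by case=> uv duv; split=> // tv; rewrite d_sym; apply: duv; rewrite uv.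
- case=> uv duv [vw dvw]; split=> [|tu]; first by rewrite uv.
  by apply: d_trans (duv tu) (dvw _); rewrite -uv.
- by split=> [|_]; [apply/txR/dt | apply: dk].
- split=> [|tp]; first exact/txR/t_poly.
  by apply: contrapT => dp; apply: nop; exists p.
Qed.

(** * Retractions onto minimal sets and inverses on them *)

Lemma image_subset (S : finType) (p : T -> S) (V : {set S}) :
  (forall x, p x \in V) -> [set p x | x : T] \subset V.
Proof. by move=> pV; apply/subsetP => _ /imsetP[x _ ->]. Qed.

Lemma minimal_set_image (U : {set T}) (p : T -> T) (x y : T) :
  minimal_set A d t U -> unary_polynomial (basic_ops A) p ->
  (forall z, p z \in U) -> t x y -> ~ d (p x) (p y) ->
  [set p z | z : T] = U.
Proof.
move=> [_ minU] Ap pU txy dp; apply: minU; last exact: image_subset.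
by exists p; split=> //; exists x, y; rewrite txy; apply/negP.
Qed.

(** [U] is contained in its image under [s], which on a finite set leaves no room for collisions. *)
Lemma image_inj (U : {set T}) (s : T -> T) :
  {in U, forall x, exists2 y, y \in U & x = s y} -> {in U &, injective s}.
Proof.
move=> sU; apply/imset_injP; rewrite eqn_leq leq_imset_card /=.
by apply/subset_leq_card/subsetP => x /sU[y Uy ->]; apply: imset_f.
Qed.

(** Write [U] as the image of [p] and choose [q] such that [p \o q \o p] still separates. By
    minimality [p \o q] then permutes [U], and a positive power of it is a retraction onto [U]. *)
Lemma minimal_set_idempotent (U : {set T}) :
  minimal_set A d t U ->
  exists e, [/\ unary_polynomial (basic_ops A) e, forall x, e x \in U &
                {in U, forall x, e x = x}].
Proof.
move=> minU; have [[p [Ap [x [y /andP[txy /negP dp]]] UE]] _] := minU.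
have pU z : p z \in U by rewrite UE imset_f.
have [q [Aq _ dq]] :=
  covers_separate (t_poly Ap txy) dp txy (d_poly Ap) dp.
have pqp_img : [set (p \o q \o p) z | z : T] = U.
  apply: minimal_set_image txy dq => // [|z]; last exact: pU.
  exact/(unary_polynomial_comp Ap)/(unary_polynomial_comp Aq).
have pqU : {in U, forall z, exists2 y, y \in U & z = p (q y)}.
  by move=> z; rewrite -{1}pqp_img => /imsetP[w _ ->]; exists (p w).
have [n nE] := iter_id_on (s := p \o q) (fun z _ => pU (q z)) (image_inj pqU).
exists (iter n.+1 (p \o q)); split=> [|z|//]; last by rewrite iterS pU.
by apply: unary_polynomial_iter; apply: (unary_polynomial_comp Ap).
Qed.

(** Since [f] separates a pair of [U], some polynomial [r] brings the images back to a pair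
    separated by [e]. By minimality [e \o r \o f] permutes [U], so a power of it inverts [f] on the
    left. *)
Lemma minimal_set_inverse (U : {set T}) (f : T -> T) (a b : T) :
  minimal_set A d t U -> unary_polynomial (basic_ops A) f ->
  a \in U -> b \in U -> t a b -> ~ d (f a) (f b) ->
  exists h, [/\ unary_polynomial (basic_ops A) h, forall x, h x \in U &
                {in U, cancel f h}].
Proof.
move=> minU Af Ua Ub tab df.
have [e [Ae eU eK]] := minimal_set_idempotent minU.
have dab : ~ d (e a) (e b) by rewrite !eK // => /(d_poly Af).
have [r [Ar _ dr]] := covers_separate (t_poly Af tab) df tab (d_poly Ae) dab.
have Aer : unary_polynomial (basic_ops A) (e \o r).
  exact: (unary_polynomial_comp Ae).
have img : [set (e \o r \o f \o e) z | z : T] = U.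
  apply: (minimal_set_image (x := a) (y := b)) => //=.
    exact/(unary_polynomial_comp Aer)/(unary_polynomial_comp Af).
  by rewrite (eK a) // (eK b).
pose s := e \o r \o f.
have sU : {in U, forall z, exists2 y, y \in U & z = s y}.
  by move=> z; rewrite -{1}img => /imsetP[w _ ->]; exists (e w).
have [n nE] := iter_id_on (s := s) (fun z _ => eU _) (image_inj sU).
(* One of the [n.+1] factors [s] is split as [e \o r] after [f]. *)
exists (iter n s \o (e \o r)); split=> [|x|x Ux].
- apply: unary_polynomial_comp (Aer); apply: unary_polynomial_iter.
  exact: (unary_polynomial_comp Aer).
- by case: n {nE} => [|n]; rewrite /= eU.
- by rewrite -[RHS]nE // iterSr.
Qed.

(** * Traces and their uniqueness up to polynomial isomorphism *)

Lemma traceP (N : {set T}) :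
  trace A d t N ->
  exists U a b, [/\ minimal_set A d t U, N = [set y in U | t a y],
    a \in U, b \in U & t a b && ~~ d a b].
Proof.
case=> U [a [minU Ua -> N_nd]].
have [b Nb dab] : exists2 b, b \in [set y in U | t a y] & ~ d a b.
  apply: contrapT => nb; apply: N_nd; apply/subsetP => b Nb; rewrite inE.
  by apply: contrapT => dab; apply: nb; exists b.
move: Nb; rewrite inE => /andP[Ub tab].
by exists U, a, b; split; rewrite // tab; apply/negP.
Qed.

(** A separating image of least cardinality is minimal under inclusion; the whole universe is a
    candidate, as the image of the identity. *)
Lemma trace_exists : exists N, trace A d t N.
Proof.
have [d_refl d_sym d_trans] := equiv_d.
have [t_refl t_sym t_trans] := equiv_t; have [_ _ _ td _] := cov.
have [a [b /andP[tab dab]]] : exists a b, t a b && ~~ d a b.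
  apply: contrapT => nab; apply: td => a b tab; apply: contrapT => dab.
  by apply: nab; exists a, b; rewrite tab; apply/negP.
pose Q n := `[< exists2 U, separating_image A d t U & #|U| = n >].
have exQ : exists n, Q n.
  exists #|[set id x | x : T]|; apply/asboolP; exists [set id x | x : T] => //.
  exists id; split=> //; first exact: unary_polynomial_id.
  by exists a, b; rewrite tab.
case: (ex_minnP exQ) => n /asboolP[U sepU cardU] minQ.
have minU : minimal_set A d t U.
  split=> // V sepV VU; apply/eqP; rewrite eqEcard VU cardU minQ //.
  by apply/asboolP; exists V.
have [p [Ap [x [y /andP[txy dp]]] UE]] := sepU.
exists [set y in U | t (p x) y], U, (p x); split=> //.
  by rewrite UE imset_f.
move=> /subsetP/(_ (p y)); rewrite !inE UE imset_f // t_poly // => /(_ isT).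
exact/negP.
Qed.

(** A polynomial [r] moves the pair of [N] into the [t]-class of [a'] so that [e] still separates
    it. Then [e \o r] has a polynomial left inverse on [U] and maps [U] onto [U'], so the inverse is
    two-sided; as polynomials preserve [t], traces go to traces. *)
Lemma trace_transport (N N' : {set T}) :
  trace A d t N -> trace A d t N' ->
  exists f h, [/\ unary_polynomial (basic_ops A) f,
    unary_polynomial (basic_ops A) h,
    {in N, forall x, f x \in N' /\ h (f x) = x} &
    {in N', forall x, h x \in N /\ f (h x) = x}].
Proof.
have [d_refl d_sym d_trans] := equiv_d.
have [t_refl t_sym t_trans] := equiv_t.
move=> /traceP[U [a [b [minU -> Ua Ub /andP[tab /negP dab]]]]].
move=> /traceP[U' [a' [b' [minU' -> Ua' Ub' /andP[tab' /negP dab']]]]].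
have [e [Ae eU' eK]] := minimal_set_idempotent minU'.
have [] := covers_separate tab dab tab' (d_poly Ae); first by rewrite !eK.
move=> r [Ar ta'r dr].
have Aer : unary_polynomial (basic_ops A) (e \o r).
  exact: (unary_polynomial_comp Ae).
have [h [Ah hU hK]] := minimal_set_inverse minU Aer Ua Ub tab dr.
have ta'f : t a' (e (r a)) by rewrite -{1}(eK _ Ua') t_poly.
have [e0 [Ae0 e0U e0K]] := minimal_set_idempotent minU.
have fhK : {in U', cancel h (e \o r)}.
  have img : [set (e \o r \o e0) z | z : T] = U'.
    apply: (minimal_set_image (x := a) (y := b)) => //=; last by rewrite !e0K.
    exact: (unary_polynomial_comp Aer).
  move=> y; rewrite -{1}img => /imsetP[w _ ->].
  by congr (e (r _)); apply: hK.
exists (e \o r), h; split=> // x; rewrite !inE => /andP[Ux tx].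
  split; last exact: hK.
  by rewrite eU' /= (t_trans _ _ _ ta'f) // (t_poly Aer).
split; last exact: fhK.
rewrite hU /= -[a]hK // t_poly //; apply: t_trans tx.
by rewrite t_sym.
Qed.

(** Mutually inverse polynomials between the traces conjugate induced operations to induced
    operations and respect [d] both ways. *)
Lemma trace_quotient_unique (N N' : {set T}) :
  trace A d t N -> trace A d t N' ->
  polynomially_isomorphic (@trace_quotient F T A d N)
    (@trace_quotient F T A d N').
Proof.
move=> trN trN'; have [f [h [Af Ah fN hN']]] := trace_transport trN trN'.
pose phi (x : {x | x \in N}) : {x | x \in N'} :=
  exist _ (f (val x)) (fN _ (valP x)).1.
pose psi (x : {x | x \in N'}) : {x | x \in N} :=
  exist _ (h (val x)) (hN' _ (valP x)).1.
apply: (quotient_isomorphic (phi := phi) (psi := psi)).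
- exact: restrict_equiv.
- exact: restrict_equiv.
- by move=> x; apply/val_inj/(fN _ (valP x)).2.
- by move=> x; apply/val_inj/(hN' _ (valP x)).2.
- move=> x y; apply/idP/idP => [/(d_poly Af)//|/(d_poly Ah)].
  by rewrite /= (fN _ (valP x)).2 (fN _ (valP y)).2.
- move=> n g [g' Ag' gE].
  exists (fun x => f (g' [ffun i => h (x i)])) => [|x].
    apply: (unary_polynomial_comp Af); apply: clone_sub Ag' _ => i.
    exact: unary_polynomial_comp Ah (clone_proj _ i).
  by rewrite /= -gE; congr (f (g' _)); apply/ffunP => i; rewrite !ffunE.
- move=> n g [g' Ag' gE].
  exists (fun x => h (g' [ffun i => f (x i)])) => [|x].
    apply: (unary_polynomial_comp Ah); apply: clone_sub Ag' _ => i.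
    exact: unary_polynomial_comp Af (clone_proj _ i).
  by rewrite /= -gE; congr (h (g' _)); apply/ffunP => i; rewrite !ffunE.
Qed.

End PrimeQuotient.

(** * The algebra of columns *)

Section Columns.

Variables (F : signature) (F_pos : forall f : symbol F, 0 < arity f).
Variables (m : nat) (I : algebra F 'I_m) (T : finType) (A : algebra F T).
Variables (chi : T -> 'I_m) (chi_hom : homomorphism A I chi).

Notation C := (column_algebra F_pos chi_hom).
Notation column_op s := (@column_algebra F F_pos m I T A chi chi_hom s).

Lemma column_eqP (c c' : column chi) :
  (forall i, val c i = val c' i) <-> c = c'.
Proof. by split=> [cc'|-> //]; apply/val_inj/ffunP. Qed.

(** The element determines its place: only entry [chi a] of a column may hold [a]. *)
Definition upd_val (u : column chi) (a : T) : {ffun 'I_m -> T} :=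
  [ffun j => if j == chi a then a else val u j].

Lemma upd_subproof (u : column chi) (a : T) :
  [forall j, chi (upd_val u a j) == j].
Proof.
apply/forallP => j; rewrite ffunE.
by case: (j =P _) => [->//|_]; rewrite columnP.
Qed.

Definition upd (u : column chi) (a : T) : column chi :=
  Sub (upd_val u a) (upd_subproof u a).

Lemma updE (u : column chi) (a : T) (j : 'I_m) :
  val (upd u a) j = if j == chi a then a else val u j.
Proof. by rewrite ffunE. Qed.

Lemma upd_chi (u : column chi) (a : T) : val (upd u a) (chi a) = a.
Proof. by rewrite updE eqxx. Qed.

Lemma column_dE (c : {ffun 'I_m -> column chi}) (j : 'I_m) :
  val (column_op (ColD F m) c) j = val (c j) j.
Proof. by rewrite ffunE. Qed.

Lemma column_hatE (f : symbol F) (i : {ffun 'I_(arity f) -> 'I_m})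
    (c : {ffun 'I_(arity f) -> column chi}) (j : 'I_m) :
  val (column_op (ColHat i) c) j =
    if j == @I f i then @A f [ffun k => val (c k) (i k)]
    else val (c (Ordinal (F_pos f))) j.
Proof. by rewrite ffunE. Qed.

Lemma column_exists :
  (forall i, exists a, chi a = i) -> exists c : column chi, True.
Proof.
move=> chi_surj; have [c cE] := fin_all_exists chi_surj.
have cP : [forall i, chi ([ffun i => c i] i) == i].
  by apply/forallP => i; rewrite ffunE cE.
by exists (Sub [ffun i => c i] cP).
Qed.

Lemma kernel_congruence : congruence A (kernel chi).
Proof.
split=> [x|x y|y x z|f x y xy]; rewrite /kernel.
- exact: eqxx.
- exact: eq_sym.
- by move=> /eqP->.
rewrite !chi_hom; apply/eqP; congr (@I _ _); apply/ffunP => k.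
by rewrite !ffunE; apply/eqP/xy.
Qed.

(** Substituting [P k i] for the coordinates avoids polynomials of arity [n * m]
    whose variables are indexed by pairs. *)
Lemma column_polynomial_coord (n : nat) (g : operation n (column chi)) :
  polynomial (basic_ops C) g ->
  forall (r : nat) (P : 'I_n -> 'I_m -> operation r T),
    (forall k i, polynomial (basic_ops A) (P k i)) ->
    forall j, exists2 Q : operation r T, polynomial (basic_ops A) Q &
      forall (x : {ffun 'I_r -> T}) (c : {ffun 'I_n -> column chi}),
        (forall k i, val (c k) i = P k i x) -> val (g c) j = Q x.
Proof.
move=> Cg r P AP; elim: Cg => [i|k h u Oh _ IH|h h' _ IH hE] j.
- by exists (P i j) => // x c; apply.
- case: Oh u IH => [[s] u IH|[a hE] u IH].
    case: s u IH => [|f i] u IH.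
      have [Q AQ QE] := IH j j; exists Q => // x c cP.
      by rewrite column_dE ffunE; apply: QE.
    case: (j =P @I f i) => [->|/eqP ji].
      (* The new entry reads coordinate [i k] of the [k]-th argument, so the induction hypothesis is
         needed at all coordinates. *)
      have [Q AQ QE] := fin_all_exists2 (fun k => IH k (i k)).
      exists (fun x => @A f [ffun k => Q k x]) => [|x c cP].
        exact: clone_sub (polynomial_op (BasicOp A f)) AQ.
      rewrite column_hatE eqxx; congr (@A f); apply/ffunP => l.
      by rewrite !ffunE; apply: QE.
    have [Q AQ QE] := IH (Ordinal (F_pos f)) j; exists Q => // x c cP.
    by rewrite column_hatE (negPf ji) ffunE; apply: QE.
  exists (fun=> val a j) => [|x c _]; first exact: polynomial_const.
  by rewrite hE.
- have [Q AQ QE] := IH j; exists Q => // x c cP.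
  by rewrite -hE; apply: QE.
Qed.

(** By induction on [G]: a hat operation indexed by the coordinates found for the subterms computes
    the outer symbol, its result standing in entry [I f jj]. Constants enter as entries of an
    updated [u]. *)
Lemma column_polynomial_lift (r : nat) (G : operation r T) (u : column chi) :
  polynomial (basic_ops A) G ->
  forall (n : nat) (H : 'I_r -> operation n (column chi)) (i : 'I_r -> 'I_m),
    (forall v, polynomial (basic_ops C) (H v)) ->
    exists H' : operation n (column chi), exists2 j,
      polynomial (basic_ops C) H' &
      forall c, val (H' c) j = G [ffun v => val (H v c) (i v)].
Proof.
move=> AG n H i CH; elim: AG => [v|k h g Oh _ IH|h h' _ [H' [j CH' HE]] hh'].
- by exists (H v), (i v) => // c; rewrite ffunE.
- case: Oh g IH => [[f] g IH|[a hE] g IH].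
    have [H' /fin_all_exists2[j CH' HE]] := fin_all_exists IH.
    pose jj := [ffun k => j k].
    exists (fun c => column_op (ColHat jj) [ffun k => H' k c]).
    exists (@I f jj) => [|c].
      exact: clone_sub (polynomial_op (@BasicOp _ _ C (ColHat jj))) CH'.
    rewrite column_hatE eqxx; congr (@A f); apply/ffunP => l.
    by rewrite !ffunE HE.
  exists (fun=> upd u a), (chi a) => [|c]; first exact: polynomial_const.
  by rewrite upd_chi hE.
- by exists H', j => // c; rewrite HE hh'.
Qed.

Lemma column_polynomial_upd (r n : nat) (G : operation r T) (u : column chi)
    (H : 'I_r -> operation n (column chi)) (i : 'I_r -> 'I_m) :
  polynomial (basic_ops A) G -> (forall v, polynomial (basic_ops C) (H v)) ->
  polynomial (basic_ops C) (fun c => upd u (G [ffun v => val (H v c) (i v)])).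
Proof.
move=> AG CH; have [H' [j CH' HE]] := column_polynomial_lift u AG i CH.
(* Fed to [d], this family takes entry [j] from the lifted polynomial and all others from [u]. *)
pose K l := if l == j then H' else fun=> u.
have CK l : polynomial (basic_ops C) (K l).
  by rewrite /K; case: eqP => // _; apply: polynomial_const.
have Cd := polynomial_op (@BasicOp _ _ C (ColD F m)).
apply: clone_ext (clone_sub Cd CK) _ => c.
apply/column_eqP => l; rewrite column_dE ffunE updE -HE columnP /K.
by case: eqP => // ->.
Qed.

(** * Congruences of the column algebra *)

Lemma star_congruence (d : rel T) : congruence A d -> congruence C (star d).
Proof.
case=> d_refl d_sym d_trans d_op; split.
- by move=> x; apply/forallP => i; apply: d_refl.
- by move=> x y; apply: eq_forallb => i; apply: d_sym.
- move=> y x z /forallP xy /forallP yz; apply/forallP => i.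
  exact: d_trans (xy i) (yz i).
- move=> [|f i] x y xy; apply/forallP => j.
    by rewrite !column_dE; apply: (forallP (xy j)).
  rewrite !column_hatE; case: eqP => _; last exact: (forallP (xy _)).
  by apply: d_op => k; rewrite !ffunE; apply: (forallP (xy k)).
Qed.

Lemma star_upd (d : rel T) (u : column chi) (a b : T) :
  reflexive d -> chi a = chi b -> star d (upd u a) (upd u b) = d a b.
Proof.
move=> d_refl ab; apply/forallP/idP => [/(_ (chi a))|dab i].
  by rewrite {2}ab !upd_chi.
by rewrite !updE -ab; case: eqP.
Qed.

Variables (d t : rel T).
Hypothesis cov : covers A d t.
Hypothesis t_alpha : subrel t (kernel chi).
Hypothesis chi_surj : forall i, exists a, chi a = i.

Let chi_t a b : t a b -> chi a = chi b.
Proof. by move/t_alpha/eqP. Qed.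

(** A congruence [g] between [star d] and [star t] induces a congruence [G] of [A] between [d] and
    [t] by one-entry updates. If [g] exceeds [star d], then [G] exceeds [d], so it is [t]; and [d]
    of the column algebra assembles any pair in [star t] from one-entry updates. *)
Lemma star_covers : covers C (star d) (star t).
Proof.
have [Ad At dt td prime_dt] := cov.
have [d_refl d_sym d_trans d_op] := Ad.
have [t_refl t_sym t_trans t_op] := At.
have [u0 _] := column_exists chi_surj.
split; [exact: star_congruence | exact: star_congruence | | |].
- by move=> x y /forallP xy; apply/forallP => i; apply/dt/xy.
- move=> std; apply: td => a b tab; have ab := chi_t tab.
  by rewrite -(star_upd u0 d_refl ab); apply: std; rewrite star_upd.
move=> g Cg dg gt; have [g_refl g_sym g_trans g_op] := Cg.
case: (pselect (subrel g (star d))) => [|ngd]; [by left | right].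
have [c [c' [gcc' ndcc']]] : exists c c', g c c' /\ ~ star d c c'.
  apply: contrapT => nc; apply: ngd => c c' gcc'; apply: contrapT => ndc.
  by apply: nc; exists c, c'.
have [i ndi] : exists i, ~ d (val c i) (val c' i).
  apply: contrapT => ni; apply: ndcc'; apply/forallP => i.
  apply: contrapT => nd.
  by apply: ni; exists i.
pose G a b := t a b && [forall u, g (upd u a) (upd u b)].
have GA : congruence A G.
  split.
  - by move=> x; rewrite /G t_refl; apply/forallP => u; apply: g_refl.
  - by move=> x y; rewrite /G t_sym; congr andb; apply: eq_forallb => u.
  - move=> y x z /andP[txy /forallP gxy] /andP[tyz /forallP gyz].
    rewrite /G (t_trans _ _ _ txy tyz); apply/forallP => u.
    exact: g_trans (gxy u) (gyz u).
  - move=> f x y Gxy.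
    have txy k : t (x k) (y k) by case/andP: (Gxy k).
    rewrite /G t_op //=; apply/forallP => u.
    pose jj := [ffun k => chi (x k)].
    (* The indices [jj] are read off from [x], so the same column term serves for [x] and for [y],
       whose entries lie in the same fibres. *)
    have E (z : {ffun 'I_(arity f) -> T}) : (forall k, chi (x k) = chi (z k)) ->
        upd u (@A f z) = column_op (ColD F m) [ffun l => if l == @I f jj
          then column_op (ColHat jj) [ffun k => upd u (z k)] else u].
      move=> xz; have jjz : jj = [ffun k => chi (z k)].
        by apply/ffunP => k; rewrite !ffunE.
      apply/column_eqP => l; rewrite column_dE updE chi_hom -jjz ffunE.
      case: eqP => // ->; rewrite column_hatE eqxx; congr (@A f).
      by apply/ffunP => k; rewrite [RHS]ffunE [jj k]ffunE xz ffunE upd_chi.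
    rewrite (E x) // (E y) => [|k]; last exact: chi_t.
    apply: (g_op) => l; rewrite !ffunE.
    case: eqP => // _; apply: (g_op) => k; rewrite !ffunE.
    by case/andP: (Gxy k) => _ /forallP.
have dG : subrel d G.
  move=> a b dab; have tab := dt _ _ dab; rewrite /G tab /=.
  by apply/forallP => u; apply/dg; rewrite star_upd //; apply: chi_t.
have Gt : subrel G t by move=> a b /andP[].
have Gi : G (val c i) (val c' i).
  rewrite /G (forallP (gt _ _ gcc') i) /=; apply/forallP => u.
  (* Any column [u] can be grafted around the [i]-th entry by [d], so the unrelated entries of [c]
     and [c'] give a pair of [G] outside [d]. *)
  have E (z : column chi) :
      upd u (val z i) =
        column_op (ColD F m) [ffun l => if l == i then z else u].
    apply/column_eqP => l; rewrite column_dE updE columnP ffunE.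
    by case: eqP => // ->.
  by rewrite !E; apply: (g_op) => l; rewrite !ffunE; case: eqP.
case: (prime_dt G GA dG Gt) => [/(_ _ _ Gi)//|tG] x y /forallP txy.
(* Both columns are assembled from updates of the same column [x], so related updates give related
   results. *)
have E (z : column chi) :
    z = column_op (ColD F m) [ffun l => upd x (val z l)].
  by apply/column_eqP => l; rewrite column_dE ffunE updE columnP eqxx.
rewrite (E x) (E y); apply: (g_op) => l; rewrite !ffunE.
by have /andP[_ /forallP] := tG _ _ (txy l).
Qed.

(** * Minimal sets and traces of the column algebra *)

Section TraceLift.

Variables (U : {set T}) (a : T) (o : column chi).
Hypotheses (minU : minimal_set A d t U) (Ua : a \in U).
Hypothesis nontrivial : exists2 b, b \in U & t a b /\ ~ d a b.

Notation i0 := (chi a).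

Definition column_lift (N : {set T}) : {set column chi} :=
  [set upd o y | y in N].

Notation U' := (column_lift [set y in U | chi y == i0]).

Lemma column_liftK (c : column chi) : c \in U' -> upd o (val c i0) = c.
Proof.
by case/imsetP => y; rewrite inE => /andP[_ /eqP yi] ->; rewrite -{1}yi upd_chi.
Qed.

Lemma column_lift_val (c : column chi) : c \in U' -> val c i0 \in U.
Proof.
by case/imsetP => y; rewrite inE => /andP[Uy /eqP yi] ->; rewrite -yi upd_chi.
Qed.

(** Freezing all entries but the [i]-th at those of [u] leaves a polynomial of [A] in one variable;
    it describes [g] only on the fibre over [i]. *)
Lemma unary_coord (g : column chi -> column chi) (i j : 'I_m) (u : column chi) :
  unary_polynomial (basic_ops C) g ->
  exists2 h, unary_polynomial (basic_ops A) h &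
    forall y, chi y = i -> val (g (upd u y)) j = h y.
Proof.
move=> Cg; pose P (k : 'I_1) l : operation 1 T :=
  if l == i then fun x => x ord0 else fun=> val u l.
have AP k l : polynomial (basic_ops A) (P k l).
  by rewrite /P; case: eqP => _; [apply: clone_proj | apply: polynomial_const].
have [Q AQ QE] := column_polynomial_coord Cg AP j.
exists (fun y => Q [ffun=> y]) => [|y yi].
  apply: clone_ext AQ _ => x; congr Q.
  by apply/ffunP => k; rewrite ffunE ord1.
rewrite -(QE [ffun=> y] [ffun=> upd u y]) ?ffunE // => k l.
by rewrite !ffunE yi /P; case: eqP => // _; rewrite ffunE.
Qed.

(** Changing [c] into [c'] entry by entry, at least one single change must already be separated by
    [g]. *)
Lemma coord_separate (g : column chi -> T) (c c' : column chi) :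
  star t c c' -> ~ d (g c) (g c') ->
  exists u x y, t x y /\ ~ d (g (upd u x)) (g (upd u y)).
Proof.
have [[d_refl d_sym d_trans _] [t_refl t_sym t_trans _] _ _ _] := cov.
move=> /forallP tcc' ndg; apply: contrapT => nsep; apply: ndg.
have [e /val_inj-> //] : exists2 e, val e = val c' & d (g c) (g e).
pose P (z : {ffun 'I_m -> T}) := exists2 e, val e = z & d (g c) (g e).
apply: (ffun_path (x := val c) (y := val c') (P := P)); first by exists c.
move=> z i _ zi [e eE dce]; rewrite -eE in zi *.
exists (upd e (val c' i)).
  by apply/ffunP => k; rewrite updE ffunE columnP.
apply: d_trans dce _; apply: contrapT => nd; apply: nsep.
exists e, (val c i), (val c' i); split=> //.
suff -> : upd e (val c i) = e by [].
apply/column_eqP => k; rewrite updE columnP; case: eqP => // ->.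
by rewrite zi.
Qed.

(** [U'] is the image of the polynomial inserting [e] of the [i0]-th entry into [o]. A separating
    [g] with image inside [U'] already separates two columns differing in one entry; along such
    columns its [i0]-th entry is a polynomial [h] of [A], and minimality of [U] makes [h] hit all of
    [U] over [i0]. *)
Lemma column_lift_minimal : minimal_set C (star d) (star t) U'.
Proof.
have [[d_refl d_sym d_trans _] [t_refl t_sym t_trans _] dt _ _] := cov.
have [Ad At _ _ _] := cov; have [b Ub [tab ndab]] := nontrivial.
have [e [Ae eU eK]] := minimal_set_idempotent cov minU.
have chi_poly p : unary_polynomial (basic_ops A) p ->
    forall x y, chi x = chi y -> chi (p x) = chi (p y).
  move=> Ap x y xy; apply/eqP.
  by apply: (unary_polynomial_congruence kernel_congruence Ap); apply/eqP.
have chi_e y : chi y = i0 -> chi (e y) = i0.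
  by move/(chi_poly _ Ae)->; rewrite eK.
have d_poly p : unary_polynomial (basic_ops A) p -> {homo p : x y / d x y}.
  exact: unary_polynomial_congruence.
split.
  exists (fun c : column chi => upd o (e (val c i0))); split.
  - apply: clone_ext (column_polynomial_upd o (fun=> i0) Ae
      (fun=> clone_proj _ ord0)) _ => c.
    by rewrite ffunE.
  - exists (upd o a), (upd o b); apply/andP; split.
      by rewrite star_upd //; apply: chi_t.
    have valb : val (upd o b) i0 = b by rewrite (chi_t tab) upd_chi.
    apply/negP; rewrite upd_chi valb (eK a) // (eK b) // star_upd //.
    exact: chi_t.
  - apply/setP => c; apply/imsetP/imsetP => -[y].
      rewrite inE => /andP[Uy /eqP yi] ->; exists (upd o y) => //.
      by rewrite -yi upd_chi eK.
    move=> _ ->; exists (e (val y i0)) => //.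
    by rewrite inE eU chi_e ?columnP /=.
move=> _ [g [Cg [c [c' /andP[tcc' /negP ndg]]] ->]] gU'.
have gcU' z : g z \in U' by apply: (subsetP gU'); apply: imset_f.
apply/eqP; rewrite eqEsubset gU'; apply/subsetP => v vU'.
have ndg0 : ~ d (val (g c) i0) (val (g c') i0).
  move=> dg; apply: ndg.
  rewrite -(column_liftK (gcU' c)) -(column_liftK (gcU' c')).
  by rewrite star_upd // !columnP.
have [u [x [y [txy ndxy]]]] :=
  coord_separate (g := fun z => val (g z) i0) tcc' ndg0.
have [h Ah hE] := unary_coord (chi x) i0 u Cg.
have hU z : chi z = chi x -> h z \in U.
  by move=> /hE<-; apply: column_lift_val.
rewrite !hE ?(chi_t txy) // in ndxy.
have Aeh : unary_polynomial (basic_ops A) (e \o h).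
  exact: (unary_polynomial_comp Ae).
have ndeh : ~ d (e (h x)) (e (h y)).
  by rewrite (eK (h x)) ?(eK (h y)) ?hU ?(chi_t txy).
(* [h] may also map other fibres of [chi] into that of [a]; as [r] sends [a]
   into the fibre of [x], already this fibre is mapped onto [U0] below. *)
have [r [Ar txr ndr]] := covers_separate cov tab ndab txy (d_poly _ Aeh) ndeh.
pose k := e \o h \o r.
have Ak : unary_polynomial (basic_ops A) k := unary_polynomial_comp Aeh Ar.
have img : [set (k \o e) z | z : T] = U.
  apply: (minimal_set_image minU (x := a) (y := b)) => //=; last first.
  - by rewrite (eK a) // (eK b).
  - by move=> z; apply: eU.
  - exact: unary_polynomial_comp Ak Ae.
have k_inj : {in U &, injective k}.
  apply: image_inj => z; rewrite -{1}img => /imsetP[w _ ->].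
  by exists (e w).
have chi_r z : chi z = i0 -> chi (r z) = chi x.
  by move=> /(chi_poly _ Ar)->; rewrite (chi_t txr).
have chi_h z : chi z = chi x -> chi (h z) = i0.
  by move=> /hE<-; rewrite columnP.
pose U0 := [set y in U | chi y == i0].
(* [k] is injective on [U] and keeps [U0] inside itself, so it permutes [U0]. *)
have kU0 : k @: U0 = U0.
  apply/eqP; rewrite eqEcard card_in_imset; last first.
    by move=> z w /setIdP[Uz _] /setIdP[Uw _]; apply: k_inj.
  rewrite leqnn andbT; apply/subsetP => _ /imsetP[z /setIdP[Uz /eqP zi] ->].
  by rewrite inE eU; apply/eqP/chi_e/chi_h/chi_r.
have /imsetP[w U0w vE] := vU'.
have : w \in k @: U0 by rewrite kU0.
case/imsetP => z /setIdP[Uz /eqP zi] wE; apply/imsetP.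
(* Here [w] is [k z], and [e] fixes [h (r z)], so the [i0]-th entry of the image is [w]. *)
exists (upd u (r z)) => //.
rewrite -[RHS]column_liftK // hE ?chi_r // vE wE /k /= eK //.
by apply/hU/chi_r.
Qed.

End TraceLift.

(** Insertion into [o] and reading entry [chi a] are mutually inverse. Polynomials of [A] lift to
    columns by [column_polynomial_upd]; column polynomials restrict by freezing the other
    entries. *)
Lemma trace_lift (N : {set T}) :
  trace A d t N ->
  exists N' : {set column chi},
    trace C (star d) (star t) N' /\
    exists phi : {x : T | x \in N} -> {c : column chi | c \in N'},
      weak_isomorphism (induced (basic_ops A) (N := N))
        (induced (basic_ops C) (N := N')) phi /\
      (forall x y, restrict d x y = restrict (star d) (phi x) (phi y)).
Proof.
have [[d_refl d_sym d_trans _] [t_refl t_sym t_trans _] dt _ _] := cov.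
case/traceP => U [a [b [minU NE Ua Ub /andP[tab /negP ndab]]]].
have [o _] := column_exists chi_surj.
have chiN x : x \in N -> chi x = chi a.
  by rewrite NE inE => /andP[_ /chi_t].
have minU' : minimal_set C (star d) (star t)
    (column_lift o [set y in U | chi y == chi a]).
  by apply: column_lift_minimal => //; exists b.
have valN' c : c \in column_lift o N -> val c (chi a) \in N.
  by case/imsetP => y Ny ->; rewrite -(chiN y) // upd_chi.
have updN x : x \in N -> upd o x \in column_lift o N.
  exact: imset_f.
exists (column_lift o N); split.
  exists (column_lift o [set y in U | chi y == chi a]), (upd o a); split=> //.
  - by apply: imset_f; rewrite inE Ua eqxx.
  - apply/setP => c; rewrite inE; apply/imsetP/andP.
      move=> [x Nx ->]; have xa := chiN _ Nx; rewrite NE inE in Nx.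
      case/andP: Nx => Ux tax; rewrite star_upd //; split=> //.
      by apply: imset_f; rewrite inE Ux xa eqxx.
    case=> /imsetP[y /setIdP[Uy /eqP ya] ->]; rewrite star_upd // => tay.
    by exists y; rewrite // NE inE Uy.
  - move/subsetP/(_ (upd o b)); rewrite inE star_upd //; last exact: chi_t.
    by move/(_ (updN b _))/ndab; apply; rewrite NE inE Ub.
pose phi (x : {x | x \in N}) : {c | c \in column_lift o N} :=
  exist _ (upd o (val x)) (updN _ (valP x)).
pose psi (c : {c | c \in column_lift o N}) : {x | x \in N} :=
  exist _ (val (val c) (chi a)) (valN' _ (valP c)).
have phiK : cancel phi psi.
  move=> x; apply: val_inj.
  by rewrite /= -(chiN (val x)) ?(valP x) //; apply: upd_chi.
have psiK : cancel psi phi.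
  move=> c; apply: val_inj; rewrite /=.
  have /imsetP[y Ny ->] := valP c.
  by rewrite -(chiN y) // upd_chi.
exists phi; split; last first.
  move=> x y; rewrite /restrict star_upd //.
  by rewrite (chiN _ (valP x)) (chiN _ (valP y)).
apply: (weak_isomorphism_conj phiK psiK) => n f [f' Pf' fE].
  apply: clone_op; exists (fun c : {ffun 'I_n -> column chi} =>
    upd o (f' [ffun v => val (c v) (chi a)])).
    exact: (column_polynomial_upd o (fun=> chi a) Pf'
      (fun v => clone_proj _ v)).
  move=> c; congr (upd o _); rewrite -fE; congr f'.
  by apply/ffunP => v; rewrite !ffunE.
(* Members of the lifted trace agree with [o] outside entry [chi a]. *)
pose P (k : 'I_n) l : operation n T :=
  if l == chi a then fun x => x k else fun=> val o l.
have AP k l : polynomial (basic_ops A) (P k l).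
  by rewrite /P; case: eqP => _; [apply: clone_proj | apply: polynomial_const].
have [Q AQ QE] := column_polynomial_coord Pf' AP (chi a).
apply: clone_op; exists Q => // x; rewrite /= -fE.
apply/esym/QE => k l; rewrite !ffunE (chiN _ (valP (x k))) /P.
by case: eqP => // _; rewrite ffunE.
Qed.

End Columns.

(** * Type 2 and the characteristic *)

Section VectorSpaces.

Import GRing.Theory.
Local Open Scope ring_scope.

Lemma linear_isomorphic (K : fieldType) (V W : lmodType K) (phi : V -> W)
    (psi : W -> V) :
  cancel phi psi -> cancel psi phi -> linear phi ->
  polynomially_isomorphic (@vector_space_ops K V) (@vector_space_ops K W).
Proof.
move=> phiK psiK phi_lin.
have phiD x y : phi (x + y) = phi x + phi y.
  by rewrite -[x]scale1r phi_lin !scale1r.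
have phi0 : phi 0 = 0.
  by apply: (addrI (phi 0)); rewrite -phiD !addr0.
have phiZ k x : phi (k *: x) = k *: phi x.
  by rewrite -[k *: x]addr0 phi_lin phi0 addr0.
have phiN x : phi (- x) = - phi x by rewrite -scaleN1r phiZ scaleN1r.
apply: (polynomially_isomorphic_conj phiK psiK) => n f [|||k].
- by apply: clone_ext (polynomial_op (VZero W)) _ => x; rewrite /conj_op phi0.
- apply: clone_ext (polynomial_op (VOpp W)) _ => x.
  by rewrite /conj_op ffunE phiN psiK.
- apply: clone_ext (polynomial_op (VAdd W)) _ => x.
  by rewrite /conj_op !ffunE phiD !psiK.
- apply: clone_ext (polynomial_op (VScale W k)) _ => x.
  by rewrite /conj_op ffunE phiZ psiK.
- apply: clone_ext (polynomial_op (VZero V)) _ => x.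
  by rewrite /conj_op -phi0 phiK.
- apply: clone_ext (polynomial_op (VOpp V)) _ => x.
  by rewrite /conj_op ffunE -phiN phiK.
- apply: clone_ext (polynomial_op (VAdd V)) _ => x.
  by rewrite /conj_op !ffunE -phiD phiK.
- apply: clone_ext (polynomial_op (VScale V k)) _ => x.
  by rewrite /conj_op ffunE -phiZ phiK.
Qed.

(** Scaling [v] is a linear bijection from [K^o]: injective as [v] is nonzero, surjective by
    hypothesis. *)
Lemma line_isomorphic (K : fieldType) (V : lmodType K) (v : V) :
  v != 0 -> (forall w, exists k, w = k *: v) ->
  polynomially_isomorphic (@vector_space_ops K V) (@vector_space_ops K K^o).
Proof.
move=> v0 /choice[phi phiE].
pose psi (k : K^o) := k *: v.
have psiK : cancel psi phi.
  move=> k; have /eqP := phiE (psi k); rewrite -subr_eq0 -scalerBl scaler_eq0.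
  by rewrite (negPf v0) orbF subr_eq0 => /eqP.
apply: polynomially_isomorphic_sym.
apply: (@linear_isomorphic K K^o V psi phi psiK) => [w|k x y].
  by rewrite /psi -phiE.
by rewrite /psi scalerDl scalerA.
Qed.

Lemma vector_space_unary (K : fieldType) (V : lmodType K) (f : operation 1 V) :
  polynomial (@vector_space_ops K V) f ->
  exists k w, forall x, f x = k *: x ord0 + w.
Proof.
elim=> [i|n h g Oh _ IH|h h' _ [k [w hE]] hh'].
- by exists 1, 0 => x; rewrite ord1 scale1r addr0.
- case: Oh g IH => [Oh|[a hE] g _]; last first.
    by exists 0, a => x; rewrite hE scale0r add0r.
  case: Oh => [|||k] g IH.
  + by exists 0, 0 => x; rewrite scale0r addr0.
  + have [l [w gE]] := IH ord0; exists (- l), (- w) => x.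
    by rewrite ffunE gE scaleNr opprD.
  + have [l [w gE]] := IH ord0; have [l' [w' gE']] := IH ord_max.
    exists (l + l'), (w + w') => x.
    by rewrite !ffunE gE gE' scalerDl addrACA.
  + have [l [w gE]] := IH ord0; exists (k * l), (k *: w) => x.
    by rewrite ffunE gE scalerDr scalerA.
- by exists k, w => x; rewrite -hh' hE.
Qed.

(** The trace modulo [d] is simple: any two elements are linked by polynomial
    images of a given pair of distinct ones.  Unary polynomials of a vector
    space being affine, all differences lie on a single line. *)
Lemma trace_quotient_line (F : signature) (T : finType) (A : algebra F T)
    (d t : rel T) (N : {set T}) (K : fieldType) (V : lmodType K) :
  covers A d t -> trace A d t N ->
  polynomially_isomorphic (@trace_quotient F T A d N)
    (@vector_space_ops K V) ->
  exists2 v : V, v != 0 & forall w, exists k, w = k *: v.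
Proof.
move=> cov trN [Phi /weak_isomorphism_inv[Psi [PhiK PsiK OV _]]].
have [Ad At dt _ _] := cov.
have [d_refl d_sym d_trans] := congruence_equiv Ad.
have [t_refl t_sym t_trans] := congruence_equiv At.
have [U [a [b [minU NE Ua Ub /andP[tab /negP ndab]]]]] := traceP trN.
have [e [Ae eU eK]] := minimal_set_idempotent cov minU.
pose r := restrict d (N := N).
have Er : [/\ reflexive r, symmetric r & transitive r] by apply: restrict_equiv.
have inN x : (x \in N) = (x \in U) && t a x by rewrite NE inE.
have Na : a \in N by rewrite inN Ua t_refl.
have Nb : b \in N by rewrite inN Ub tab.
(* The vector attached to the block of [x]; the value [0] outside [N] is only a default. *)
pose val_of x : V :=
  if insub x is Some z then Phi (block r (z : {x | x \in N})) else 0.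
have val_ofE z : val_of (val z) = Phi (block r z) by rewrite /val_of valK.
have val_of_d x y : x \in N -> y \in N -> (d x y <-> val_of x = val_of y).
  move=> Nx Ny.
  rewrite (val_ofE (exist _ x Nx)) (val_ofE (exist _ y Ny)); split.
    by move=> dxy; congr Phi; apply/(eq_blockP Er).
  by move/(can_inj PhiK)/(eq_blockP Er).
have val_of_affine p : unary_polynomial (basic_ops A) p ->
    {in N, forall x, p x \in N} ->
    exists k w, {in N, forall x, val_of (p x) = k *: val_of x + w}.
  move=> Ap pN; pose g (x : {x | x \in N}) : {x | x \in N} :=
    exist _ (p (val x)) (pN _ (valP x)).
  have g_r : {homo g : x y / r x y}.
    by move=> x y; apply: (unary_polynomial_congruence Ad Ap).
  have Og : @trace_quotient F T A d N 1 (fun B => block_map r g (B ord0)).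
    apply/(quotient_opsP Er); exists (fun x => g (x ord0)) => [|x].
      by exists (fun x => p (x ord0)) => // x; rewrite ffunE.
    by rewrite ffunE (block_map_block Er Er _ g_r).
  have /OV/vector_space_unary[k [w gE]] := polynomial_op Og.
  exists k, w => x Nx; have := gE [ffun=> val_of x].
  rewrite /conj_op !ffunE (val_ofE (exist _ x Nx)) PhiK.
  by rewrite (block_map_block Er Er _ g_r) -val_ofE.
pose v := val_of a - val_of b; exists v.
  by rewrite subr_eq0; apply/eqP => /(val_of_d _ _ Na Nb).
(* Within the [t]-class of [a], the retraction [e] lands in [N], where differences can be measured
   against [v]. *)
pose R x y := (t a x = t a y) /\
  (t a x -> exists k, val_of (e x) - val_of (e y) = k *: v).
have eN x : t a x -> e x \in N.
  move=> tax; rewrite inN eU -[a]eK //.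
  exact: (unary_polynomial_congruence At Ae).
have t_iff x y : t x y -> t a x = t a y.
  by move=> txy; apply/idP/idP => /t_trans; apply; rewrite // t_sym.
have tR x y : t x y -> R x y.
  apply: (covers_generated cov tab ndab) => {x y} [x|x y|x y z|x y dxy|p Ap].
  - by split=> // _; exists 0; rewrite subrr scale0r.
  - case=> xy kxy; split=> // tay; have [|k kE] := kxy; first by rewrite xy.
    by exists (- k); rewrite scaleNr -kE opprB.
  - case=> xy kxy [yz kyz]; split=> [|tax]; first by rewrite xy.
    have [k kE] := kxy tax; have [|l lE] := kyz; first by rewrite -xy.
    by exists (k + l); rewrite scalerDl -kE -lE addrA subrK.
  - have txy := t_iff _ _ (dt _ _ dxy); split=> // tax; exists 0.
    rewrite scale0r; apply/eqP; rewrite subr_eq0; apply/eqP/val_of_d.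
    + exact: eN.
    + by apply: eN; rewrite -txy.
    + exact: (unary_polynomial_congruence Ad Ae).
  - split=> [|tap]; first exact/t_iff/(unary_polynomial_congruence At Ap).
    (* As [p a] lies in the class of [a], the map [e \o p] preserves [N] and is affine there; its
       linear part scales [v]. *)
    have [||k [w kE]] := val_of_affine (e \o p).
    + exact: unary_polynomial_comp Ae Ap.
    + move=> x; rewrite inN => /andP[_ tax]; apply: eN.
      exact: t_trans tap (unary_polynomial_congruence At Ap tax).
    + exists k; move: (kE _ Na) (kE _ Nb) => /= -> ->.
      by rewrite /v scalerBr opprD addrACA subrr addr0.
(* Any vector [w] is the difference between the vectors of some [c] in [N] and of [b]. *)
move=> w; have [c cE] : exists c : {x | x \in N}, val_of (val c) = w + val_of b.
  by exists (block_repr (Psi (w + val_of b))); rewrite val_ofE block_reprK PsiK.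
have := valP c; rewrite inN => /andP[Uc tac].
have [|_ /(_ tac)[k]] := tR (val c) b.
  by apply: t_trans tab; rewrite t_sym.
by rewrite !eK // cE addrK => ->; exists k.
Qed.

End VectorSpaces.

Lemma affine_characteristic (F : signature) (T : finType) (A : algebra F T)
    (d t : rel T) (N : {set T}) :
  covers A d t -> trace A d t N ->
  minimal_algebra_type (@trace_quotient F T A d N) Type2_affine ->
  exists (K : finFieldType) (p : nat),
    [/\ prime p, p \in [pchar K]%R &
        polynomially_isomorphic (@trace_quotient F T A d N)
          (@vector_space_ops K K^o%type)].
Proof.
move=> cov trN [_ [K [V NV]]]; have [p p_prime pK] := finPcharP K.
have [v v0 vE] := trace_quotient_line cov trN NV.
exists K, p; split=> //; apply: polynomially_isomorphic_trans NV _.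
exact: line_isomorphic v0 vE.
Qed.

(** The clones of induced algebras are the induced algebras themselves, so conjugation matches their
    operations and descends to blocks. *)
Lemma weak_isomorphism_trace_quotient (F F' : signature) (T T' : finType)
    (A : algebra F T) (B : algebra F' T') (d : rel T) (d' : rel T')
    (N : {set T}) (N' : {set T'}) (phi : {x | x \in N} -> {x | x \in N'}) :
  congruence A d -> congruence B d' ->
  weak_isomorphism (induced (basic_ops A) (N := N))
    (induced (basic_ops B) (N := N')) phi ->
  (forall x y, restrict d x y = restrict d' (phi x) (phi y)) ->
  polynomially_isomorphic (@trace_quotient F T A d N)
    (@trace_quotient F' T' B d' N').
Proof.
move=> /congruence_equiv Ed /congruence_equiv Ed'.
move=> /weak_isomorphism_inv[psi [phiK psiK AB BA]] phi_d.
apply: (quotient_isomorphic _ _ phiK psiK phi_d) => [||n f Of|n f Of].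
- exact: restrict_equiv.
- exact: restrict_equiv.
- exact/clone_induced/AB/clone_op.
- exact/clone_induced/BA/clone_op.
Qed.

(** * Transfer of traces, type and characteristic *)

Theorem theorem3p13 (F : signature) (F_pos : forall f : symbol F, 0 < arity f)
    (m : nat) (I : algebra F 'I_m) (T : finType) (A : algebra F T)
    (chi : T -> 'I_m) (chi_hom : homomorphism A I chi)
    (chi_surj : forall i : 'I_m, exists a : T, chi a = i)
    (delta theta : rel T) (cov : covers A delta theta)
    (theta_alpha : subrel theta (kernel chi)) :
  let C := column_algebra F_pos chi_hom in
  let delta' : rel (column chi) := star delta in
  let theta' : rel (column chi) := star theta in
  [/\ forall N : {set T}, trace A delta theta N ->
        exists N' : {set column chi},
          trace C delta' theta' N' /\
          exists phi : {x : T | x \in N} -> {c : column chi | c \in N'},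
            weak_isomorphism (induced (basic_ops A) (N := N))
              (induced (basic_ops C) (N := N')) phi /\
            (forall x y, restrict delta x y
                         = restrict delta' (phi x) (phi y)),
      forall i : tct_type,
        has_type A delta theta i <-> has_type C delta' theta' i &
      has_type A delta theta Type2_affine ->
        exists p : nat,
          [/\ prime p, has_characteristic A delta theta p &
              has_characteristic C delta' theta' p]].
Proof.
move=> C delta' theta'.
have lift :=
  @trace_lift _ F_pos _ _ _ _ _ chi_hom _ _ cov theta_alpha chi_surj.
have cov' : covers C delta' theta' by apply: star_covers.
have [[Ad _ _ _ _] [Cd _ _ _ _]] := (cov, cov').
have lift_iso N : trace A delta theta N -> exists2 N' : {set column chi},
    trace C delta' theta' N' & polynomially_isomorphic
      (@trace_quotient F T A delta N) (@trace_quotient _ _ C delta' N').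
  move=> /lift[N' [trN' [phi [iso phi_d]]]]; exists N' => //.
  exact: weak_isomorphism_trace_quotient iso phi_d.
have [N0 trN0] := trace_exists cov; have [N0' trN0' iso0] := lift_iso _ trN0.
split=> [//|i|[_ type2]].
  (* A trace of the column algebra is compared with [N0'], the lift of [N0]; a trace of [A] is
     compared with its own lift. *)
  split=> -[_ type_i]; split=> // N trN.
    have := type_i _ trN0; apply: minimal_algebra_type_isomorphic.
    exact: polynomially_isomorphic_trans iso0
      (trace_quotient_unique cov' trN0' trN).
  have [N' trN' iso] := lift_iso _ trN.
  have := type_i _ trN'; apply: minimal_algebra_type_isomorphic.
  exact: polynomially_isomorphic_sym.
(* The field found at [N0] serves for every trace on either side. *)
have [K [p [p_prime pK isoK]]] := affine_characteristic cov trN0 (type2 _ trN0).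
exists p; split=> //; split=> // N trN; exists K; split=> //.
  have isoN := trace_quotient_unique cov trN trN0.
  exact: polynomially_isomorphic_trans isoN isoK.
apply: polynomially_isomorphic_trans (trace_quotient_unique cov' trN trN0') _.
exact: polynomially_isomorphic_trans (polynomially_isomorphic_sym iso0) isoK.
Qed.
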